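(* Suppose $b>1$, and fix all model parameters and demands described in the context except $\alpha$. Then there exist $\underline{\alpha}>0$ and $\alpha^{*}<1$ such that for all $\alpha\in(0,1)$ with $\alpha<\underline{\alpha}$ and all $\alpha\in(0,1)$ with $\alpha>\alpha^{*}$, the Price of Anarchy $\mathrm{PoA}(\beta^{\mathrm{UE}},\beta^{\mathrm{SO}})$ equals $1$. Moreover, for any $\alpha\in(0,1)$, if $\beta^{\mathrm{SO}}\in(0,1)$ and $$\left(x^{pv}+(1-\beta^{\mathrm{SO}})x^{rs}\right)\frac{\partial t_{\mathcal V}}{\partial\beta}+\beta^{\mathrm{SO}}x^{rs}\frac{\partial t_{\mathcal B}}{\partial\beta}+x^b\frac{\partial t_b}{\partial\beta}=0,$$ where the derivatives are those of $\beta\mapsto t_{\mathcal V}((1-\beta)x^{rs})$, $\beta\mapsto t_{\mathcal B}(\beta x^{rs})$, $\beta\mapsto t_b(\beta x^{rs})$ evaluated at $\beta=\beta^{\mathrm{SO}}$, then the Price of Anarchy is also $1$.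
   Context: Parameters: $t_f>0$, $C>0$, $a>0$, $b>0$, $o^p>1$ (pool occupancy), $\Delta_p>1$, $\Delta_b>1$ (detour factors), $\gamma>0$. Demands: private vehicles $x^{pv}>0$, ride-hailing $x^{rs}>0$, bus users $x^b>0$, and bus flow $f_b>0$ with $f_b<x^b$. The constant $\omega=\omega(n_e)\in(0,1]$ is fixed (capacity reduction due to a fixed number $n_e\ge 0$ of empty vehicles; it does not depend on $\alpha$). The constant $k=k(f_b)$ is the value at $f_b$ of a continuously differentiable function $k:[0,\infty)\to(0,\infty)$ with $k'>0$ and $k(0)>1$; in particular $k>1$. The space split is $\alpha\in(0,1)$: a fraction $\alpha$ goes to the vehicle network and $1-\alpha$ to the bus network. Delay functions, for solo demand $x^s\ge 0$ and pool demand $x^p\ge 0$: $$t_{\mathcal V}(x^s)=t_f\left(1+a\left(\frac{x^{pv}+x^s}{\omega\alpha C}\right)^b\right),\qquad t_{\mathcal B}(x^p)=t_f\left(1+a\left(\frac{\frac{x^p}{o^p}+f_b}{(1-\alpha)C}\right)^b\right)\Delta_p k,$$ $$t_b(x^p)=t_f\left(1+a\left(\frac{\frac{x^p}{o^p}+f_b}{(1-\alpha)C}\right)^b\right)\Delta_b k+\gamma .$$ For $\beta\in[0,1]$ (the fraction of ride-hailing users who pool), the total passenger hours travelled are $$\mathrm{PHT}(\beta)=x^{pv}t_{\mathcal V}((1-\beta)x^{rs})+(1-\beta)x^{rs}t_{\mathcal V}((1-\beta)x^{rs})+\beta x^{rs}t_{\mathcal B}(\beta x^{rs})+x^b t_b(\beta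 x^{rs}).$$ The system optimum is $\beta^{\mathrm{SO}}\in\operatorname*{arg\,min}_{\beta\in[0,1]}\mathrm{PHT}(\beta)$ (unique when $b>1$). The user (Wardrop) equilibrium is the unique $$\beta^{\mathrm{UE}}\in\operatorname*{arg\,min}_{\beta\in[0,1]}\int_0^{(1-\beta)x^{rs}}t_{\mathcal V}(s)\,ds+\int_0^{\beta x^{rs}}t_{\mathcal B}(s)\,ds .$$ The Price of Anarchy is $\mathrm{PoA}(\beta^{\mathrm{UE}},\beta^{\mathrm{SO}})=\mathrm{PHT}(\beta^{\mathrm{UE}})/\mathrm{PHT}(\beta^{\mathrm{SO}})$. *)

(* Defs.v *)
(* Stdlib real numbers, with Coquelicot for derivatives and integrals. *)
From Stdlib Require Import Reals.
From Coquelicot Require Import Coquelicot.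
Open Scope R_scope.

Record params : Type := Params {
  t_f : R;           (* free-flow travel time *)
  C : R;             (* total road capacity *)
  a : R;
  b : R;
  o_p : R;           (* pool occupancy *)
  Delta_p : R;       (* detour factor of pooled vehicles *)
  Delta_b : R;       (* detour factor of buses *)
  gamma : R;
  omega : R;         (* capacity reduction due to the empty vehicles *)
  kfun : R -> R;     (* only its values on [0, +oo) are constrained *)
  x_pv : R;          (* private-vehicle demand *)
  x_rs : R;          (* ride-hailing demand *)
  x_b : R;           (* bus users *)
  f_b : R            (* bus flow *)
}.

(* [D_in] and [continue_in] are relative to [0, +oo), hence one-sided at 0. *)
Definition C1_increasing_on_nonneg (k : R -> R) : Prop :=
  exists dk : R -> R,
    forall x : R, 0 <= x ->
      D_in k dk (fun y => 0 <= y) x /\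
      continue_in dk (fun y => 0 <= y) x /\
      0 < dk x.

Record admissible (p : params) : Prop := Admissible {
  t_f_pos : 0 < t_f p;
  C_pos : 0 < C p;
  a_pos : 0 < a p;
  b_pos : 0 < b p;
  o_p_gt1 : 1 < o_p p;
  Delta_p_gt1 : 1 < Delta_p p;
  Delta_b_gt1 : 1 < Delta_b p;
  gamma_pos : 0 < gamma p;
  omega_range : 0 < omega p <= 1;
  kfun_pos : forall x : R, 0 <= x -> 0 < kfun p x;
  kfun_C1 : C1_increasing_on_nonneg (kfun p);
  kfun_0 : 1 < kfun p 0;
  x_pv_pos : 0 < x_pv p;
  x_rs_pos : 0 < x_rs p;
  x_b_pos : 0 < x_b p;
  f_b_pos : 0 < f_b p;
  f_b_lt : f_b p < x_b p
}.

(* [Rpower] is the real power only for a positive base.  This is the case below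
   for admissible parameters, 0 < alpha < 1 and nonnegative demands, because
   x_pv > 0 and f_b > 0. *)

Definition t_V (p : params) (alpha xs : R) : R :=
  t_f p * (1 + a p * Rpower ((x_pv p + xs) / (omega p * alpha * C p)) (b p)).

Definition t_B (p : params) (alpha xp : R) : R :=
  t_f p * (1 + a p * Rpower ((xp / o_p p + f_b p) / ((1 - alpha) * C p)) (b p))
  * Delta_p p * kfun p (f_b p).

Definition t_b (p : params) (alpha xp : R) : R :=
  t_f p * (1 + a p * Rpower ((xp / o_p p + f_b p) / ((1 - alpha) * C p)) (b p))
  * Delta_b p * kfun p (f_b p) + gamma p.

(* Total passenger hours travelled; beta is the fraction of ride-hailing users
   who pool. *)
Definition PHT (p : params) (alpha beta : R) : R :=
  x_pv p * t_V p alpha ((1 - beta) * x_rs p)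
  + (1 - beta) * x_rs p * t_V p alpha ((1 - beta) * x_rs p)
  + beta * x_rs p * t_B p alpha (beta * x_rs p)
  + x_b p * t_b p alpha (beta * x_rs p).

Definition UE_potential (p : params) (alpha beta : R) : R :=
  RInt (t_V p alpha) 0 ((1 - beta) * x_rs p)
  + RInt (t_B p alpha) 0 (beta * x_rs p).

Definition is_argmin_01 (F : R -> R) (beta : R) : Prop :=
  0 <= beta <= 1 /\ forall beta' : R, 0 <= beta' <= 1 -> F beta <= F beta'.

Definition is_SO (p : params) (alpha beta : R) : Prop :=
  is_argmin_01 (PHT p alpha) beta.

Definition is_UE (p : params) (alpha beta : R) : Prop :=
  is_argmin_01 (UE_potential p alpha) beta.

Definition PoA (p : params) (alpha betaUE betaSO : R) : R :=
  PHT p alpha betaUE / PHT p alpha betaSO.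

(* Main.v *)
(** Write [V], [B], [S] for the vehicle, pool and bus delays as functions of beta.  The potential
    has derivative [x_rs (B - V)] and PHT has derivative [x_rs (B - V) + W],
    where [W] is the sum in the last hypothesis.  A minimiser over [0,1] is
    pinned down to a point by the sign of the derivative on either side of it.
    As alpha -> 0, [V] blows up while [B], [B'] and [S'] stay bounded, so both
    derivatives are negative and both minimisers are 1; as alpha -> 1, [B] blows
    up while [V] and [V'] stay bounded, and both minimisers are 0.  If [W]
    vanishes at an interior optimum, then so does [B - V], and strict
    monotonicity of [B - V] makes this optimum the equilibrium. *)

Require Import Defs.
From Stdlib Require Import Reals Lra.
From Coquelicot Require Import Coquelicot.
Open Scope R_scope.

(** * Minimisers on [0,1] and differentiation of integrals *)

(** By the mean value theorem, a minimiser on either side of [c] would have a strictly larger value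
    than [c]. Nothing is asked of the sign at [c] itself, so corners and interior points are treated
    alike. *)
Lemma is_argmin_01_unique_of_derive (F dF : R -> R) (c x : R) :
  0 <= c <= 1 ->
  (forall y, 0 <= y <= 1 -> is_derive F y (dF y)) ->
  (forall y, 0 <= y < c -> dF y < 0) ->
  (forall y, c < y <= 1 -> 0 < dF y) ->
  is_argmin_01 F x -> x = c.
Proof.
  intros Hc HF Hneg Hpos [Hx Hmin].
  specialize (Hmin c Hc).
  destruct (Rtotal_order x c) as [Hlt | [Heq | Hgt]]; [exfalso | exact Heq | exfalso].
  - destruct (MVT_cor2 F dF x c Hlt) as [y [Hy Hyxc]].
    { intros y Hy; apply is_derive_Reals, HF; lra. }
    assert (dF y < 0) by (apply Hneg; lra).
    nra.
  - destruct (MVT_cor2 F dF c x Hgt) as [y [Hy Hyxc]].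
    { intros y Hy; apply is_derive_Reals, HF; lra. }
    assert (0 < dF y) by (apply Hpos; lra).
    nra.
Qed.

Lemma is_argmin_01_derive_eq_0 (F : R -> R) (l x : R) :
  is_argmin_01 F x -> 0 < x < 1 -> is_derive F x l -> l = 0.
Proof.
  intros [_ Hmin] Hx HF.
  apply is_derive_Reals in HF.
  (* With this witness [derive_pt F x pr] reduces to [l], so Fermat's rule applies by conversion. *)
  pose (pr := exist _ l HF : derivable_pt F x).
  change l with (derive_pt F x pr).
  apply (deriv_minimum F 0 1 x pr); try lra.
  intros y H0 H1; apply Hmin; lra.
Qed.

(** A two-sided derivative at [x = 0] needs the integral slightly below 0 too, hence the margin [m].
    The delays have such a margin because [x_pv] and [f_b] are positive. *)
Lemma is_derive_RInt_0 (f : R -> R) (m x : R) :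
  0 < m -> (forall z, - m < z -> continuous f z) -> 0 <= x ->
  is_derive (RInt f 0) x (f x).
Proof.
  intros Hm Hf Hx.
  apply is_derive_RInt with (a := 0); [| apply Hf; lra].
  exists (mkposreal m Hm); intros y Hy.
  change (Rabs (y - x) < m) in Hy.
  apply Rabs_def2 in Hy.
  apply (RInt_correct (V := R_CompleteNormedModule)),
    (ex_RInt_continuous (V := R_CompleteNormedModule)).
  intros z Hz; apply Hf.
  apply Rlt_le_trans with (2 := proj1 Hz).
  apply Rmin_glb_lt; lra.
Qed.

(** * Delays as functions of flow and capacity *)

(* The delay of a road of capacity [c] carrying the flow [v], before detours. *)
Definition bpr (p : params) (c v : R) : R :=
  t_f p * (1 + a p * Rpower (v / c) (b p)).

Definition dbpr (p : params) (c v : R) : R :=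
  t_f p * a p * (b p * Rpower (v / c) (b p - 1) / c).

(** Flows and capacities are arranged so that [t_V] at [(1 - beta) * x_rs] is convertible to [bpr]
    at [cap_V] and [flow_V], and similarly for the congestion factor of [t_B] and [t_b]. The
    [change] steps below rely on this. *)
Definition flow_V (p : params) (beta : R) : R := x_pv p + (1 - beta) * x_rs p.

Definition flow_B (p : params) (beta : R) : R := beta * x_rs p / o_p p + f_b p.

Definition cap_V (p : params) (alpha : R) : R := omega p * alpha * Defs.C p.

Definition cap_B (p : params) (alpha : R) : R := (1 - alpha) * Defs.C p.

Definition dt_V (p : params) (alpha beta : R) : R :=
  - x_rs p * dbpr p (cap_V p alpha) (flow_V p beta).

(** Derivative of the congestion factor shared by [t_B] and [t_b], before the detour factors and
    [k]. *)
Definition dt_pool (p : params) (alpha beta : R) : R :=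
  x_rs p / o_p p * dbpr p (cap_B p alpha) (flow_B p beta).

(** The sum W, in the shape that the theorem's hypothesis takes once its three derivatives are
    evaluated, so that [fold] recognises it. *)
Definition marginal_congestion (p : params) (alpha beta : R) : R :=
  (x_pv p + (1 - beta) * x_rs p) * dt_V p alpha beta
  + beta * x_rs p * (dt_pool p alpha beta * Delta_p p * kfun p (f_b p))
  + x_b p * (dt_pool p alpha beta * Delta_b p * kfun p (f_b p)).

Definition delay_gap (p : params) (alpha beta : R) : R :=
  t_B p alpha (beta * x_rs p) - t_V p alpha ((1 - beta) * x_rs p).

Section Admissible.

Variable p : params.
Hypothesis hp : admissible p.

(** * Derivative, monotonicity and blow-up of the congestion function *)

Lemma is_derive_bpr (c v : R) :
  0 < c -> 0 < v -> is_derive (bpr p c) v (dbpr p c v).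
Proof.
  intros Hc Hv.
  unfold bpr, dbpr, Rpower.
  assert (Hvc : 0 < v / c) by (apply Rdiv_lt_0_compat; assumption).
  auto_derive; [exact Hvc |].
  (* Splitting the exponent turns the power [b - 1] into the power [b] divided by [v / c], the form
     produced by the chain rule. *)
  replace ((b p - 1) * ln (v / c)) with (b p * ln (v / c) + - ln (v / c)) by ring.
  rewrite exp_plus, exp_Ropp, exp_ln by exact Hvc.
  unfold Rdiv; field; lra.
Qed.

Lemma bpr_pos (c v : R) : 0 < bpr p c v.
Proof.
  unfold bpr.
  pose proof (t_f_pos p hp); pose proof (a_pos p hp).
  assert (0 < Rpower (v / c) (b p)) by apply exp_pos.
  apply Rmult_lt_0_compat; nra.
Qed.

Lemma dbpr_pos (c v : R) : 0 < c -> 0 < dbpr p c v.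
Proof.
  intros Hc; unfold dbpr.
  pose proof (t_f_pos p hp); pose proof (a_pos p hp); pose proof (b_pos p hp).
  assert (0 < Rpower (v / c) (b p - 1)) by apply exp_pos.
  apply Rmult_lt_0_compat; [nra |].
  apply Rdiv_lt_0_compat; nra.
Qed.

Lemma bpr_lt (c v v' : R) : 0 < c -> 0 < v < v' -> bpr p c v < bpr p c v'.
Proof.
  intros Hc Hv; unfold bpr.
  apply Rmult_lt_compat_l; [exact (t_f_pos p hp) |].
  apply Rplus_lt_compat_l, Rmult_lt_compat_l; [exact (a_pos p hp) |].
  apply Rlt_Rpower_l; [exact (b_pos p hp) |].
  assert (0 < / c) by (apply Rinv_0_lt_compat; exact Hc).
  unfold Rdiv; split; nra.
Qed.

(** Flow and capacity vary together, so that one bound at an extreme flow and a reference capacity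
    serves all [beta] and a whole range of [alpha]. *)
Lemma flow_ratio_le (c c' v v' : R) :
  0 < c' <= c -> 0 < v <= v' -> 0 < v / c <= v' / c'.
Proof.
  intros Hc Hv.
  split; [apply Rdiv_lt_0_compat; lra |].
  apply Rmult_le_compat; try lra.
  - apply Rlt_le, Rinv_0_lt_compat; lra.
  - apply Rinv_le_contravar; lra.
Qed.

Lemma bpr_le (c c' v v' : R) :
  0 < c' <= c -> 0 < v <= v' -> bpr p c v <= bpr p c' v'.
Proof.
  intros Hc Hv; unfold bpr.
  apply Rmult_le_compat_l; [exact (Rlt_le _ _ (t_f_pos p hp)) |].
  apply Rplus_le_compat_l, Rmult_le_compat_l; [exact (Rlt_le _ _ (a_pos p hp)) |].
  apply Rle_Rpower_l; [exact (Rlt_le _ _ (b_pos p hp)) |].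
  apply flow_ratio_le; assumption.
Qed.

(** Since [b > 1], the exponent [b - 1] is positive and the power still increases with the ratio. *)
Lemma dbpr_le (c c' v v' : R) :
  1 < b p -> 0 < c' <= c -> 0 < v <= v' -> dbpr p c v <= dbpr p c' v'.
Proof.
  intros hb Hc Hv; unfold dbpr.
  pose proof (t_f_pos p hp); pose proof (a_pos p hp).
  assert (0 < Rpower (v / c) (b p - 1)) by apply exp_pos.
  assert (Rpower (v / c) (b p - 1) <= Rpower (v' / c') (b p - 1)).
  { apply Rle_Rpower_l; [lra | apply flow_ratio_le; assumption]. }
  apply Rmult_le_compat_l; [nra |].
  apply Rmult_le_compat; [nra | | nra |].
  - apply Rlt_le, Rinv_0_lt_compat; lra.
  - apply Rinv_le_contravar; lra.
Qed.

(** Once [v / c] is at least 1, its power [b > 1] dominates the ratio itself, which is unbounded as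
    [c] tends to 0. *)
Lemma bpr_unbounded (v K : R) :
  1 < b p -> 0 < v ->
  exists c0, 0 < c0 /\ forall c, 0 < c < c0 -> K < bpr p c v.
Proof.
  intros hb Hv.
  pose proof (t_f_pos p hp); pose proof (a_pos p hp).
  assert (Hta : 0 < t_f p * a p) by nra.
  (* Chosen so that [t_f * a * Y] exceeds [K] and [Y] is at least 1; the condition [c < v / Y] means
     [v / c > Y]. *)
  set (Y := 1 + Rabs K / (t_f p * a p)).
  assert (HY : 1 <= Y).
  { unfold Y; pose proof (Rabs_pos K).
    assert (0 <= Rabs K / (t_f p * a p)) by (apply Rdiv_le_0_compat; assumption).
    lra. }
  exists (v / Y); split; [apply Rdiv_lt_0_compat; lra |].
  intros c [Hc HcY].
  assert (HYc : Y < v / c).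
  { apply Rlt_div_r; [exact Hc |].
    apply Rlt_div_r in HcY; lra. }
  assert (Hpow : v / c <= Rpower (v / c) (b p)).
  { rewrite <- (Rpower_1 (v / c)) at 1 by lra.
    apply Rle_Rpower; lra. }
  assert (HK : t_f p * a p * Y = t_f p * a p + Rabs K) by (unfold Y; field; lra).
  pose proof (Rle_abs K).
  assert (t_f p * a p * Y < t_f p * a p * Rpower (v / c) (b p))
    by (apply Rmult_lt_compat_l; lra).
  unfold bpr; nra.
Qed.

(** * Signs and uniform bounds for capacities, flows and slopes *)

Lemma kfun_f_b_pos : 0 < kfun p (f_b p).
Proof. apply (kfun_pos p hp), Rlt_le, (f_b_pos p hp). Qed.

Lemma cap_V_pos (alpha : R) : 0 < alpha -> 0 < cap_V p alpha.
Proof.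
  intros H; unfold cap_V.
  pose proof (C_pos p hp); pose proof (proj1 (omega_range p hp)).
  apply Rmult_lt_0_compat; nra.
Qed.

Lemma cap_B_pos (alpha : R) : alpha < 1 -> 0 < cap_B p alpha.
Proof. intros H; unfold cap_B; pose proof (C_pos p hp); nra. Qed.

Lemma flow_V_bounds (beta : R) :
  0 <= beta <= 1 -> x_pv p <= flow_V p beta <= x_pv p + x_rs p.
Proof. intros H; unfold flow_V; pose proof (x_rs_pos p hp); nra. Qed.

Lemma pool_flow_pos : 0 < x_rs p / o_p p.
Proof.
  pose proof (x_rs_pos p hp); pose proof (o_p_gt1 p hp).
  apply Rdiv_lt_0_compat; lra.
Qed.

Lemma flow_B_bounds (beta : R) :
  0 <= beta <= 1 -> f_b p <= flow_B p beta <= x_rs p / o_p p + f_b p.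
Proof.
  intros H; unfold flow_B; pose proof pool_flow_pos.
  replace (beta * x_rs p / o_p p) with (beta * (x_rs p / o_p p))
    by (unfold Rdiv; ring).
  nra.
Qed.

Lemma dt_V_neg (alpha beta : R) : 0 < alpha -> dt_V p alpha beta < 0.
Proof.
  intros H; unfold dt_V; pose proof (x_rs_pos p hp).
  pose proof (dbpr_pos (cap_V p alpha) (flow_V p beta) (cap_V_pos alpha H)).
  nra.
Qed.

Lemma dt_pool_pos (alpha beta : R) : alpha < 1 -> 0 < dt_pool p alpha beta.
Proof.
  intros H; unfold dt_pool.
  apply Rmult_lt_0_compat; [exact pool_flow_pos |].
  apply dbpr_pos, cap_B_pos, H.
Qed.

(** * Derivatives of the delays, of PHT and of the potential *)

Lemma is_derive_t_V (alpha beta : R) :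
  0 < alpha -> 0 <= beta <= 1 ->
  is_derive (fun y : R => t_V p alpha ((1 - y) * x_rs p)) beta (dt_V p alpha beta).
Proof.
  intros Ha Hb.
  apply (is_derive_comp (bpr p (cap_V p alpha)) (flow_V p)).
  - apply is_derive_bpr; [apply cap_V_pos, Ha |].
    pose proof (flow_V_bounds beta Hb); pose proof (x_pv_pos p hp); lra.
  - unfold flow_V; auto_derive; [exact I | ring].
Qed.

Lemma is_derive_pool_delay (alpha beta : R) :
  alpha < 1 -> 0 <= beta <= 1 ->
  is_derive (fun y : R => bpr p (cap_B p alpha) (flow_B p y)) beta (dt_pool p alpha beta).
Proof.
  intros Ha Hb.
  apply (is_derive_comp (bpr p (cap_B p alpha)) (flow_B p)).
  - apply is_derive_bpr; [apply cap_B_pos, Ha |].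
    pose proof (flow_B_bounds beta Hb); pose proof (f_b_pos p hp); lra.
  - unfold flow_B; auto_derive; [exact I |].
    pose proof (o_p_gt1 p hp); field; lra.
Qed.

Lemma is_derive_t_B (alpha beta : R) :
  alpha < 1 -> 0 <= beta <= 1 ->
  is_derive (fun y : R => t_B p alpha (y * x_rs p)) beta
    (dt_pool p alpha beta * Delta_p p * kfun p (f_b p)).
Proof.
  intros Ha Hb.
  pose proof (is_derive_pool_delay alpha beta Ha Hb) as Hd.
  (* [P] is made abstract so that [auto_derive] leaves its [Derive] symbolic; [Hd] then evaluates
     it. *)
  set (P := fun y => bpr p (cap_B p alpha) (flow_B p y)).
  change (is_derive P beta (dt_pool p alpha beta)) in Hd.
  change (is_derive (fun y => P y * Delta_p p * kfun p (f_b p)) beta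
            (dt_pool p alpha beta * Delta_p p * kfun p (f_b p))).
  clearbody P.
  auto_derive; [now exists (dt_pool p alpha beta) |].
  change (fun y => P y) with P.
  rewrite (is_derive_unique _ _ _ Hd); ring.
Qed.

Lemma is_derive_t_b (alpha beta : R) :
  alpha < 1 -> 0 <= beta <= 1 ->
  is_derive (fun y : R => t_b p alpha (y * x_rs p)) beta
    (dt_pool p alpha beta * Delta_b p * kfun p (f_b p)).
Proof.
  intros Ha Hb.
  pose proof (is_derive_pool_delay alpha beta Ha Hb) as Hd.
  set (P := fun y => bpr p (cap_B p alpha) (flow_B p y)).
  change (is_derive P beta (dt_pool p alpha beta)) in Hd.
  change (is_derive (fun y => P y * Delta_b p * kfun p (f_b p) + gamma p) beta
            (dt_pool p alpha beta * Delta_b p * kfun p (f_b p))).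
  clearbody P.
  auto_derive; [now exists (dt_pool p alpha beta) |].
  change (fun y => P y) with P.
  rewrite (is_derive_unique _ _ _ Hd); ring.
Qed.

(** The product rule separates moving users between networks at fixed delays, [x_rs * delay_gap],
    from the change of delay felt by all users. *)
Lemma is_derive_PHT (alpha beta : R) :
  0 < alpha < 1 -> 0 <= beta <= 1 ->
  is_derive (PHT p alpha) beta
    (x_rs p * delay_gap p alpha beta + marginal_congestion p alpha beta).
Proof.
  intros Ha Hb.
  pose proof (is_derive_t_V alpha beta (proj1 Ha) Hb) as HV.
  pose proof (is_derive_t_B alpha beta (proj2 Ha) Hb) as HB.
  pose proof (is_derive_t_b alpha beta (proj2 Ha) Hb) as HS.
  unfold delay_gap, marginal_congestion.
  set (V := fun y => t_V p alpha ((1 - y) * x_rs p)).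
  set (B := fun y => t_B p alpha (y * x_rs p)).
  set (S := fun y => t_b p alpha (y * x_rs p)).
  change (is_derive V beta (dt_V p alpha beta)) in HV.
  change (is_derive B beta (dt_pool p alpha beta * Delta_p p * kfun p (f_b p))) in HB.
  change (is_derive S beta (dt_pool p alpha beta * Delta_b p * kfun p (f_b p))) in HS.
  change (t_V p alpha ((1 - beta) * x_rs p)) with (V beta).
  change (t_B p alpha (beta * x_rs p)) with (B beta).
  change (is_derive (fun y => x_pv p * V y + (1 - y) * x_rs p * V y
                              + y * x_rs p * B y + x_b p * S y) beta
    (x_rs p * (B beta - V beta)
     + ((x_pv p + (1 - beta) * x_rs p) * dt_V p alpha beta
        + beta * x_rs p * (dt_pool p alpha beta * Delta_p p * kfun p (f_b p))
        + x_b p * (dt_pool p alpha beta * Delta_b p * kfun p (f_b p))))).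
  clearbody V B S.
  auto_derive.
  - repeat split; eexists; eassumption.
  - change (fun x => V x) with V; change (fun x => B x) with B;
      change (fun x => S x) with S.
    rewrite (is_derive_unique _ _ _ HV), (is_derive_unique _ _ _ HB),
      (is_derive_unique _ _ _ HS).
    ring.
Qed.

Lemma continuous_t_V (alpha s : R) :
  0 < alpha -> - x_pv p < s -> continuous (t_V p alpha) s.
Proof.
  intros Ha Hs.
  apply (continuous_comp (fun s => x_pv p + s) (bpr p (cap_V p alpha))).
  - apply (ex_derive_continuous (fun s => x_pv p + s)); auto_derive; exact I.
  - apply (ex_derive_continuous (bpr p (cap_V p alpha))).
    eexists; apply is_derive_bpr; [apply cap_V_pos, Ha | lra].
Qed.

Lemma continuous_t_B (alpha s : R) :
  alpha < 1 -> - (f_b p) < s -> continuous (t_B p alpha) s.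
Proof.
  intros Ha Hs.
  pose proof (o_p_gt1 p hp); pose proof (f_b_pos p hp).
  assert (Hflow : 0 < s / o_p p + f_b p).
  { assert (- f_b p < s / o_p p); [| lra].
    apply Rlt_div_r; nra. }
  apply (continuous_comp (fun s => bpr p (cap_B p alpha) (s / o_p p + f_b p))
           (fun t => t * Delta_p p * kfun p (f_b p))).
  - apply (continuous_comp (fun s => s / o_p p + f_b p) (bpr p (cap_B p alpha))).
    + apply (ex_derive_continuous (fun s => s / o_p p + f_b p)); auto_derive; lra.
    + apply (ex_derive_continuous (bpr p (cap_B p alpha))).
      eexists; apply is_derive_bpr; [apply cap_B_pos, Ha | exact Hflow].
  - apply (ex_derive_continuous (fun t => t * Delta_p p * kfun p (f_b p))).
    auto_derive; exact I.
Qed.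

(** Fundamental theorem of calculus with upper limits moving at speeds [- x_rs] and [x_rs]. The
    endpoints [beta = 1] and [beta = 0] are where the integrals need their margin below 0. *)
Lemma is_derive_UE_potential (alpha beta : R) :
  0 < alpha < 1 -> 0 <= beta <= 1 ->
  is_derive (UE_potential p alpha) beta (x_rs p * delay_gap p alpha beta).
Proof.
  intros Ha Hb.
  pose proof (x_rs_pos p hp).
  assert (HV : is_derive (fun y => RInt (t_V p alpha) 0 ((1 - y) * x_rs p)) beta
                 (- x_rs p * t_V p alpha ((1 - beta) * x_rs p))).
  { apply (is_derive_comp (RInt (t_V p alpha) 0) (fun y => (1 - y) * x_rs p)).
    - apply is_derive_RInt_0 with (m := x_pv p); [exact (x_pv_pos p hp) | | nra].
      intros z Hz; apply continuous_t_V; lra.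
    - auto_derive; [exact I | ring]. }
  assert (HB : is_derive (fun y => RInt (t_B p alpha) 0 (y * x_rs p)) beta
                 (x_rs p * t_B p alpha (beta * x_rs p))).
  { apply (is_derive_comp (RInt (t_B p alpha) 0) (fun y => y * x_rs p)).
    - apply is_derive_RInt_0 with (m := f_b p); [exact (f_b_pos p hp) | | nra].
      intros z Hz; apply continuous_t_B; lra.
    - auto_derive; [exact I | ring]. }
  unfold delay_gap.
  replace (x_rs p * (t_B p alpha (beta * x_rs p) - t_V p alpha ((1 - beta) * x_rs p)))
    with (plus (- x_rs p * t_V p alpha ((1 - beta) * x_rs p))
               (x_rs p * t_B p alpha (beta * x_rs p)))
    by (unfold plus; simpl; ring).
  exact (is_derive_plus (V := R_NormedModule) _ _ _ _ _ HV HB).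
Qed.

(** More pooling unloads the vehicle network and loads the bus network, so V falls and B rises. *)
Lemma delay_gap_increasing (alpha beta beta' : R) :
  0 < alpha < 1 -> 0 <= beta -> beta < beta' -> beta' <= 1 ->
  delay_gap p alpha beta < delay_gap p alpha beta'.
Proof.
  intros Ha H0 H1 H2.
  pose proof (x_rs_pos p hp); pose proof (x_pv_pos p hp); pose proof (f_b_pos p hp).
  assert (HV : bpr p (cap_V p alpha) (flow_V p beta')
               < bpr p (cap_V p alpha) (flow_V p beta)).
  { apply bpr_lt; [apply cap_V_pos; lra | unfold flow_V; nra]. }
  assert (HB : bpr p (cap_B p alpha) (flow_B p beta)
               < bpr p (cap_B p alpha) (flow_B p beta')).
  { apply bpr_lt; [apply cap_B_pos; lra |].
    pose proof (flow_B_bounds beta ltac:(lra)).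
    split; [lra |].
    unfold flow_B; apply Rplus_lt_compat_r.
    pose proof pool_flow_pos; unfold Rdiv in *; nra. }
  assert (HDk : 0 < Delta_p p * kfun p (f_b p)).
  { pose proof kfun_f_b_pos; pose proof (Delta_p_gt1 p hp); nra. }
  unfold delay_gap.
  change (t_V p alpha ((1 - beta) * x_rs p))
    with (bpr p (cap_V p alpha) (flow_V p beta)).
  change (t_V p alpha ((1 - beta') * x_rs p))
    with (bpr p (cap_V p alpha) (flow_V p beta')).
  change (t_B p alpha (beta * x_rs p))
    with (bpr p (cap_B p alpha) (flow_B p beta) * Delta_p p * kfun p (f_b p)).
  change (t_B p alpha (beta' * x_rs p))
    with (bpr p (cap_B p alpha) (flow_B p beta') * Delta_p p * kfun p (f_b p)).
  nra.
Qed.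

(** * Positivity of PHT *)

(** Makes the quotient [PoA] meaningful. The private and bus terms are strictly positive, while a
    ride-hailing term may vanish at a corner. *)
Lemma PHT_pos (alpha beta : R) : 0 <= beta <= 1 -> 0 < PHT p alpha beta.
Proof.
  intros Hb; unfold PHT.
  pose proof (x_rs_pos p hp); pose proof (x_pv_pos p hp); pose proof (x_b_pos p hp).
  pose proof kfun_f_b_pos; pose proof (Delta_p_gt1 p hp);
    pose proof (Delta_b_gt1 p hp); pose proof (gamma_pos p hp).
  pose proof (bpr_pos (cap_V p alpha) (flow_V p beta)) as HV.
  pose proof (bpr_pos (cap_B p alpha) (flow_B p beta)) as HP.
  assert (HB : 0 < t_B p alpha (beta * x_rs p)).
  { change (0 < bpr p (cap_B p alpha) (flow_B p beta) * Delta_p p * kfun p (f_b p)).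
    apply Rmult_lt_0_compat; [apply Rmult_lt_0_compat |]; lra. }
  assert (HS : 0 < t_b p alpha (beta * x_rs p)).
  { apply Rplus_lt_0_compat; [| lra].
    change (0 < bpr p (cap_B p alpha) (flow_B p beta) * Delta_b p * kfun p (f_b p)).
    apply Rmult_lt_0_compat; [apply Rmult_lt_0_compat |]; lra. }
  change (0 < t_V p alpha ((1 - beta) * x_rs p)) in HV.
  assert (0 < x_pv p * t_V p alpha ((1 - beta) * x_rs p)) by nra.
  assert (0 < x_b p * t_b p alpha (beta * x_rs p)) by nra.
  assert (0 <= (1 - beta) * x_rs p * t_V p alpha ((1 - beta) * x_rs p))
    by (apply Rmult_le_pos; nra).
  assert (0 <= beta * x_rs p * t_B p alpha (beta * x_rs p))
    by (apply Rmult_le_pos; nra).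
  lra.
Qed.

Lemma PoA_diag (alpha beta : R) : 0 <= beta <= 1 -> PoA p alpha beta beta = 1.
Proof.
  intros Hb; unfold PoA.
  pose proof (PHT_pos alpha beta Hb); field; lra.
Qed.

(** * Signs of both derivatives for extreme space splits *)

Lemma derivatives_negative_small_alpha :
  1 < b p ->
  exists alpha_low, 0 < alpha_low /\
    forall alpha beta, 0 < alpha < 1 -> alpha < alpha_low -> 0 <= beta <= 1 ->
      delay_gap p alpha beta < 0 /\
      x_rs p * delay_gap p alpha beta + marginal_congestion p alpha beta < 0.
Proof.
  intros hb.
  pose proof (x_rs_pos p hp) as Hrs; pose proof (x_pv_pos p hp) as Hpv;
    pose proof (x_b_pos p hp) as Hxb; pose proof (f_b_pos p hp) as Hfb.
  pose proof kfun_f_b_pos as Hk; pose proof (Delta_p_gt1 p hp) as HDp;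
    pose proof (Delta_b_gt1 p hp) as HDb.
  pose proof pool_flow_pos as Hpool; pose proof (C_pos p hp) as HC;
    pose proof (proj1 (omega_range p hp)) as Hom.
  (* For [alpha < 1/2], the largest pool flow on the capacity at 1/2 is the worst case for the
     congestion factor and its slope. *)
  set (M := bpr p (cap_B p (1 / 2)) (x_rs p / o_p p + f_b p)).
  set (M' := x_rs p / o_p p * dbpr p (cap_B p (1 / 2)) (x_rs p / o_p p + f_b p)).
  (* [x_rs * K] is the sum of upper bounds for [x_rs * B] and for the two positive terms of W. *)
  set (K := M * Delta_p p * kfun p (f_b p)
            + M' * Delta_p p * kfun p (f_b p)
            + x_b p * (M' * Delta_b p * kfun p (f_b p)) / x_rs p).
  (* The least vehicle flow is [x_pv], so the threshold [c0] works for every [beta]. *)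
  destruct (bpr_unbounded (x_pv p) K hb Hpv) as [c0 [Hc0 Hbig]].
  assert (HoC : 0 < omega p * Defs.C p) by nra.
  exists (Rmin (1 / 2) (c0 / (omega p * Defs.C p))).
  split; [apply Rmin_glb_lt; [lra | apply Rdiv_lt_0_compat; assumption] |].
  intros alpha beta Ha Hlow Hb.
  assert (Hhalf : alpha < 1 / 2)
    by (apply Rlt_le_trans with (1 := Hlow), Rmin_l).
  assert (Hcap : cap_V p alpha < c0).
  { assert (Hc : alpha < c0 / (omega p * Defs.C p))
      by (apply Rlt_le_trans with (1 := Hlow), Rmin_r).
    apply Rlt_div_r in Hc; [unfold cap_V; lra | exact HoC]. }
  pose proof (cap_V_pos alpha (proj1 Ha)) as HcV.
  assert (HV : K < t_V p alpha ((1 - beta) * x_rs p)).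
  { apply Rlt_le_trans with (1 := Hbig _ (conj HcV Hcap)).
    apply (bpr_le _ (cap_V p alpha) _ (flow_V p beta)); [lra |].
    pose proof (flow_V_bounds beta Hb); lra. }
  assert (HcB : 0 < cap_B p (1 / 2) <= cap_B p alpha)
    by (unfold cap_B; split; nra).
  pose proof (flow_B_bounds beta Hb) as HfB.
  assert (HM : bpr p (cap_B p alpha) (flow_B p beta) <= M)
    by (apply bpr_le; lra).
  assert (HM' : dt_pool p alpha beta <= M').
  { apply Rmult_le_compat_l; [lra |]. apply dbpr_le; lra. }
  pose proof (dt_pool_pos alpha beta (proj2 Ha)) as Hpos.
  set (d := dt_pool p alpha beta) in *.
  pose proof (dt_V_neg alpha beta (proj1 Ha)) as HdV.
  set (X := Delta_p p * kfun p (f_b p)).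
  set (Y := Delta_b p * kfun p (f_b p)).
  assert (HX : 0 < X) by (unfold X; nra).
  assert (HY : 0 < Y) by (unfold Y; nra).
  assert (HK : x_rs p * K = x_rs p * (M * X) + x_rs p * (M' * X) + x_b p * (M' * Y))
    by (unfold K, X, Y; field; lra).
  assert (HB : t_B p alpha (beta * x_rs p) <= M * X).
  { change (t_B p alpha (beta * x_rs p))
      with (bpr p (cap_B p alpha) (flow_B p beta) * Delta_p p * kfun p (f_b p)).
    rewrite Rmult_assoc; apply Rmult_le_compat_r; [apply Rlt_le, HX | exact HM]. }
  assert (HdX : 0 < d * X <= M' * X) by (split; nra).
  assert (HdY : 0 < d * Y <= M' * Y) by (split; nra).
  assert (H1 : beta * x_rs p * (d * X) <= x_rs p * (M' * X)).
  { apply Rmult_le_compat; nra. }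
  assert (H2 : x_b p * (d * Y) <= x_b p * (M' * Y))
    by (apply Rmult_le_compat_l; lra).
  assert (H3 : (x_pv p + (1 - beta) * x_rs p) * dt_V p alpha beta <= 0).
  { assert (0 < x_pv p + (1 - beta) * x_rs p) by nra. nra. }
  assert (H4 : 0 < x_rs p * (M' * X)) by (apply Rmult_lt_0_compat; lra).
  assert (H5 : 0 < x_b p * (M' * Y)) by (apply Rmult_lt_0_compat; lra).
  assert (Hgap : x_rs p * delay_gap p alpha beta < x_rs p * (M * X) - x_rs p * K).
  { unfold delay_gap. rewrite <- Rmult_minus_distr_l.
    apply Rmult_lt_compat_l; lra. }
  split; [nra |].
  unfold marginal_congestion; fold d.
  rewrite !(Rmult_assoc d); fold X Y; lra.
Qed.

Lemma derivatives_positive_large_alpha :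
  1 < b p ->
  exists alpha_star, alpha_star < 1 /\
    forall alpha beta, 0 < alpha < 1 -> alpha_star < alpha -> 0 <= beta <= 1 ->
      0 < delay_gap p alpha beta /\
      0 < x_rs p * delay_gap p alpha beta + marginal_congestion p alpha beta.
Proof.
  intros hb.
  pose proof (x_rs_pos p hp) as Hrs; pose proof (x_pv_pos p hp) as Hpv;
    pose proof (x_b_pos p hp) as Hxb; pose proof (f_b_pos p hp) as Hfb.
  pose proof kfun_f_b_pos as Hk; pose proof (Delta_p_gt1 p hp) as HDp;
    pose proof (Delta_b_gt1 p hp) as HDb.
  pose proof (C_pos p hp) as HC; pose proof (proj1 (omega_range p hp)) as Hom.
  set (X := Delta_p p * kfun p (f_b p)).
  set (Y := Delta_b p * kfun p (f_b p)).
  assert (HX : 0 < X) by (unfold X; nra).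
  assert (HY : 0 < Y) by (unfold Y; nra).
  set (M := bpr p (cap_V p (1 / 2)) (x_pv p + x_rs p)).
  set (M' := dbpr p (cap_V p (1 / 2)) (x_pv p + x_rs p)).
  (* [M] bounds V and the second summand bounds the size of the only negative term of W, divided by
     [x_rs]. *)
  set (K := M + (x_pv p + x_rs p) * M').
  (* B is the congestion factor times [X], and [f_b] is its least flow. *)
  destruct (bpr_unbounded (f_b p) (K / X) hb Hfb) as [c0 [Hc0 Hbig]].
  exists (Rmax (1 / 2) (1 - c0 / Defs.C p)).
  split.
  { apply Rmax_lub_lt; [lra |].
    assert (0 < c0 / Defs.C p) by (apply Rdiv_lt_0_compat; assumption); lra. }
  intros alpha beta Ha Hstar Hb.
  assert (Hhalf : 1 / 2 < alpha)
    by (apply Rle_lt_trans with (2 := Hstar), Rmax_l).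
  assert (Hcap : cap_B p alpha < c0).
  { assert (Hc : 1 - c0 / Defs.C p < alpha)
      by (apply Rle_lt_trans with (2 := Hstar), Rmax_r).
    assert (Hc' : 1 - alpha < c0 / Defs.C p) by lra.
    apply Rlt_div_r in Hc'; [exact Hc' | exact HC]. }
  pose proof (cap_B_pos alpha (proj2 Ha)) as HcB.
  pose proof (flow_B_bounds beta Hb) as HfB.
  pose proof (flow_V_bounds beta Hb) as HfV.
  assert (HB : K < t_B p alpha (beta * x_rs p)).
  { change (t_B p alpha (beta * x_rs p))
      with (bpr p (cap_B p alpha) (flow_B p beta) * Delta_p p * kfun p (f_b p)).
    rewrite Rmult_assoc; fold X.
    apply (Rlt_div_l K _ X HX).
    apply Rlt_le_trans with (1 := Hbig _ (conj HcB Hcap)).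
    apply bpr_le; lra. }
  assert (HcV : 0 < cap_V p (1 / 2) <= cap_V p alpha).
  { split; [apply cap_V_pos; lra |].
    unfold cap_V; apply Rmult_le_compat_r; [lra |].
    apply Rmult_le_compat_l; lra. }
  assert (HM : t_V p alpha ((1 - beta) * x_rs p) <= M).
  { apply (bpr_le (cap_V p alpha) _ (flow_V p beta)); lra. }
  assert (HM' : dbpr p (cap_V p alpha) (flow_V p beta) <= M')
    by (apply dbpr_le; lra).
  assert (HdV : 0 < dbpr p (cap_V p alpha) (flow_V p beta))
    by (apply dbpr_pos; lra).
  pose proof (dt_pool_pos alpha beta (proj2 Ha)) as Hpos.
  set (d := dt_pool p alpha beta) in *.
  assert (HdX : 0 < d * X) by nra.
  assert (HdY : 0 < d * Y) by nra.
  assert (H1 : 0 <= beta * x_rs p * (d * X)) by (apply Rmult_le_pos; nra).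
  assert (H2 : 0 < x_b p * (d * Y)) by nra.
  assert (Hflow : (x_pv p + (1 - beta) * x_rs p)
                    * dbpr p (cap_V p alpha) (flow_V p beta)
                  <= (x_pv p + x_rs p) * M').
  { apply Rmult_le_compat; unfold flow_V in HfV; lra. }
  assert (H3 : - (x_rs p * ((x_pv p + x_rs p) * M'))
               <= (x_pv p + (1 - beta) * x_rs p) * dt_V p alpha beta).
  { unfold dt_V; nra. }
  assert (H4 : 0 < (x_pv p + x_rs p) * M') by (apply Rmult_lt_0_compat; lra).
  assert (Hgap : (x_pv p + x_rs p) * M' < delay_gap p alpha beta)
    by (unfold delay_gap; unfold K in HB; lra).
  split; [lra |].
  unfold marginal_congestion; fold d.
  rewrite !(Rmult_assoc d); fold X Y; nra.
Qed.

End Admissible.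

(** * Coincidence of equilibrium and optimum, at a corner or in the interior *)

Theorem theorem2 (p : params) (hp : admissible p) (hb : 1 < b p) :
  (exists alpha_low alpha_star : R,
      0 < alpha_low /\ alpha_star < 1 /\
      forall alpha : R, 0 < alpha < 1 ->
        alpha < alpha_low \/ alpha_star < alpha ->
        forall betaUE betaSO : R,
          is_UE p alpha betaUE -> is_SO p alpha betaSO ->
          PoA p alpha betaUE betaSO = 1)
  /\
  (forall alpha : R, 0 < alpha < 1 ->
     forall betaUE betaSO : R,
       is_UE p alpha betaUE -> is_SO p alpha betaSO ->
       0 < betaSO < 1 ->
       (x_pv p + (1 - betaSO) * x_rs p)
         * Derive (fun beta => t_V p alpha ((1 - beta) * x_rs p)) betaSO
       + betaSO * x_rs p
         * Derive (fun beta => t_B p alpha (beta * x_rs p)) betaSO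
       + x_b p
         * Derive (fun beta => t_b p alpha (beta * x_rs p)) betaSO = 0 ->
       PoA p alpha betaUE betaSO = 1).
Proof.
  pose proof (x_rs_pos p hp) as Hrs.
  split.
  - destruct (derivatives_negative_small_alpha p hp hb) as [alpha_low [Hlow Hneg]].
    destruct (derivatives_positive_large_alpha p hp hb) as [alpha_star [Hstar Hpos]].
    exists alpha_low, alpha_star.
    split; [exact Hlow | split; [exact Hstar |]].
    intros alpha Ha Hcase betaUE betaSO HUE HSO.
    (* The common corner is 1 (all pool) for small [alpha] and 0 for large [alpha]. *)
    assert (Hcorner : exists c, 0 <= c <= 1 /\ betaUE = c /\ betaSO = c).
    { destruct Hcase as [Hc | Hc]; [exists 1 | exists 0];
        (split; [lra | split]);
        [ refine (is_argmin_01_unique_of_derive _ _ _ _ _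
                    (fun y => is_derive_UE_potential p hp alpha y Ha) _ _ HUE)
        | refine (is_argmin_01_unique_of_derive _ _ _ _ _
                    (fun y => is_derive_PHT p hp alpha y Ha) _ _ HSO)
        | refine (is_argmin_01_unique_of_derive _ _ _ _ _
                    (fun y => is_derive_UE_potential p hp alpha y Ha) _ _ HUE)
        | refine (is_argmin_01_unique_of_derive _ _ _ _ _
                    (fun y => is_derive_PHT p hp alpha y Ha) _ _ HSO) ];
        try lra; intros y Hy; try lra.
      - pose proof (proj1 (Hneg alpha y Ha Hc ltac:(lra))); nra.
      - apply (proj2 (Hneg alpha y Ha Hc ltac:(lra))).
      - pose proof (proj1 (Hpos alpha y Ha Hc ltac:(lra))); nra.
      - apply (proj2 (Hpos alpha y Ha Hc ltac:(lra))). }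
    destruct Hcorner as [c [Hc [-> ->]]].
    apply PoA_diag; assumption.
  - intros alpha Ha betaUE betaSO HUE HSO Hint Hsum.
    assert (HSO01 : 0 <= betaSO <= 1) by lra.
    rewrite (is_derive_unique _ _ _ (is_derive_t_V p hp alpha betaSO (proj1 Ha) HSO01)),
      (is_derive_unique _ _ _ (is_derive_t_B p hp alpha betaSO (proj2 Ha) HSO01)),
      (is_derive_unique _ _ _ (is_derive_t_b p hp alpha betaSO (proj2 Ha) HSO01)) in Hsum.
    fold (marginal_congestion p alpha betaSO) in Hsum.
    pose proof (is_argmin_01_derive_eq_0 _ _ _ HSO Hint
                  (is_derive_PHT p hp alpha betaSO Ha HSO01)) as Hfoc.
    (* With W = 0, the first-order condition leaves [x_rs * delay_gap = 0]. *)
    assert (Hgap : delay_gap p alpha betaSO = 0) by nra.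
    assert (Heq : betaUE = betaSO).
    (* The increasing gap vanishes at [betaSO], so the potential's derivative changes sign exactly
       there. *)
    { refine (is_argmin_01_unique_of_derive _ _ _ _ HSO01
                (fun y => is_derive_UE_potential p hp alpha y Ha) _ _ HUE);
        intros y Hy.
      - pose proof (delay_gap_increasing p hp alpha y betaSO Ha
                      ltac:(lra) ltac:(lra) ltac:(lra)); nra.
      - pose proof (delay_gap_increasing p hp alpha betaSO y Ha
                      ltac:(lra) ltac:(lra) ltac:(lra)); nra. }
    rewrite Heq; apply PoA_diag; assumption.
Qed.
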